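(* All permutations in the group $G_n$ generated by local logic gates acting on the set of binary strings of length $n$ have complexity at most $$\frac{2n^2}{\log_2 n-1}+2n\log_2 n+n+\left\lceil\frac n2\right\rceil ,$$ where the complexity of a permutation is the minimum number of local logic gates whose composition is equal to the permutation.
   Context: Here $n$ is a positive integer, and binary strings of length $n$ are identified with vectors in $\mathbb Z_2^n$, where $\mathbb Z_2$ is the field with two elements. Local logic gate: let $\sigma$ be any permutation of the four-element set $\mathbb Z_2^2$ (the binary strings of length 2) and let $1\le i<j\le n$. The induced permutation $\sigma_{i,j}$ of $\mathbb Z_2^n$ replaces the coordinates $c_i$ and $c_j$ of a vector $(c_1,\dots,c_n)$ by the first and second components of $\sigma(c_i,c_j)$ respectively, and leaves all other coordinates unchanged. The permutations $\sigma_{i,j}$ are called local logic gates, and $G_n$ is the group of permutations of $\mathbb Z_2^n$ that they generate. *)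

(* Defs.v *)
From HB Require Import structures.
From mathcomp Require Import all_boot all_order all_algebra all_fingroup.
From mathcomp Require Import reals exp.

Set Implicit Arguments.
Unset Strict Implicit.
Unset Printing Implicit Defensive.

Import GRing.Theory.

Notation bitstring n := 'rV['F_2]_n.

Section LocalGates.
Variable n : nat.
Local Open Scope ring_scope.

Definition index_pair := {ij : 'I_n * 'I_n | (ij.1 < ij.2)%N}.

Definition coord_pair (i j : 'I_n) (c : bitstring n) : bitstring 2 :=
  \row_(k < 2) (if k == 0 then c 0 i else c 0 j).

Definition local_gate_fun (s : {perm bitstring 2}) (i j : 'I_n)
    (c : bitstring n) : bitstring n :=
  \row_(k < n) (if k == i then s (coord_pair i j c) 0 0
                else if k == j then s (coord_pair i j c) 0 1
                else c 0 k).

Lemma local_gate_fun_inj (s : {perm bitstring 2}) (ij : index_pair) :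
  injective (local_gate_fun s (val ij).1 (val ij).2).
Proof.
case: ij => -[i j] /= ltij c d /rowP eq_cd.
have neq_ji : (j == i) = false by apply/negbTE; rewrite neq_ltn ltij orbT.
have eq_s : s (coord_pair i j c) = s (coord_pair i j d).
  apply/rowP => k; have /orP[/eqP-> | /eqP->] : (k == 0) || (k == 1).
  - by case: k => -[|[|]].
  - by have := eq_cd i; rewrite !mxE eqxx.
  - by have := eq_cd j; rewrite !mxE neq_ji eqxx.
have /rowP eq_ij := perm_inj eq_s.
apply/rowP => k; have := eq_cd k; rewrite !mxE.
have [-> _|_] := eqVneq k i; first by have := eq_ij 0; rewrite !mxE eqxx.
by have [-> _|//] := eqVneq k j; have := eq_ij 1; rewrite !mxE.
Qed.

Definition local_gate (s : {perm bitstring 2}) (ij : index_pair) :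
    {perm bitstring n} :=
  perm (@local_gate_fun_inj s ij).

Definition local_gates : {set {perm bitstring n}} :=
  [set local_gate s ij | s in {perm bitstring 2}, ij in {: index_pair}].

Definition gate_group : {group {perm bitstring n}} := <<local_gates>>%G.

(* In {perm _}, (g * h)%g applies g first; the empty product is the identity. *)
Definition composition_of_gates (g : {perm bitstring n}) (k : nat) : bool :=
  [exists w : k.-tuple {perm bitstring n},
     all [in local_gates] w && (g == (\prod_(h <- w) h)%g)].

Lemma gate_group_composition (g : {perm bitstring n}) :
  g \in gate_group -> exists k, composition_of_gates g k.
Proof.
case/gen_prodgP => k [c gates_c ->]; exists k.
apply/existsP; exists [tuple c i | i < k]; apply/andP; split.
  by apply/allP => _ /mapP[i _ ->]; apply: gates_c.
by rewrite big_tuple; apply/eqP/eq_bigr => i _; rewrite tnth_mktuple.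
Qed.

Definition complexity (g : {perm bitstring n}) (Gg : g \in gate_group) : nat :=
  ex_minn (gate_group_composition Gg).

End LocalGates.

Definition log2 (R : realType) (x : R) : R := (ln x / ln 2)%R.

(* Main.v *)
Require Import Defs.
From HB Require Import structures.
From mathcomp Require Import all_boot all_order all_algebra all_fingroup.
From mathcomp Require Import reals exp.
From mathcomp Require Import zify lra.

(* Every permutation of the four-element plane over F_2 is affine, so a member
   of the group acts as c |-> c *m A + b with A invertible.  The translation by
   b takes one gate per pair of coordinates.  Row additions are gates, and A is
   reduced to the identity by sections of m = floor(log2 n) columns: m^2 row
   additions turn m rows into pivot rows that are the identity on the section,
   and the other rows are then cleared with n + 2^m row additions.  To clear
   the rows whose last nonzero section entry lies in the column of a given pivot
   row, that pivot row is made to run, one row addition at a time, through all its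
   sums with the preceding pivot rows; each of those rows is cleared by a single
   addition when the accumulator agrees with it on the section. *)

Set Implicit Arguments.
Unset Strict Implicit.
Unset Printing Implicit Defensive.

Import Order.TTheory GRing.Theory Num.Theory.
Local Open Scope ring_scope.

Lemma F2_addrr (x : 'F_2) : x + x = 0.
Proof. by apply: addrr_pchar2; apply: pchar_Fp. Qed.

Lemma F2_addrK (x y : 'F_2) : x + y + y = x.
Proof. by rewrite -addrA F2_addrr addr0. Qed.

Lemma F2_neq0 (x : 'F_2) : x != 0 -> x = 1.
Proof. by case: x => -[|[|]] // lt_x _; apply: val_inj. Qed.

(** * Row additions on square matrices over F_2 *)

Section RowAdditions.
Variable n : nat.
Implicit Types (A B C : 'M['F_2]_n) (i j k l a p : 'I_n) (s : seq 'I_n).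
Implicit Types T : {set 'I_n}.

Definition row_addition i j : 'M['F_2]_n := 1%:M + delta_mx i j.

Lemma row_additionE i j A k l :
  (row_addition i j *m A) k l = A k l + if k == i then A j l else 0.
Proof.
rewrite mulmxDl mul1mx [LHS]mxE [X in _ + X]mxE; congr (_ + _).
rewrite (bigD1 j) //= mxE eqxx andbT big1 ?addr0 => [|m /negPf neq_mj].
  by case: (k == i); rewrite ?mul1r ?mul0r.
by rewrite mxE neq_mj andbF mul0r.
Qed.

Lemma row_additionK i j :
  i != j -> row_addition i j *m row_addition i j = 1%:M.
Proof.
move=> neq_ij; apply/matrixP => k l.
rewrite row_additionE !mxE [j == i]eq_sym (negPf neq_ij) /= addr0.
case: (k == i); rewrite /= ?addr0 // (eq_sym j l).
by case: (l == j); rewrite /= ?F2_addrK ?addr0.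
Qed.

(* [reach m A B]: at most [m] row additions turn [A] into [B]. *)
Inductive reach : nat -> 'M['F_2]_n -> 'M['F_2]_n -> Prop :=
| reach_refl m A : reach m A A
| reach_step m i j A B :
    i != j -> reach m (row_addition i j *m A) B -> reach m.+1 A B.

Lemma reach_le m m' A B : (m <= m')%N -> reach m A B -> reach m' A B.
Proof.
move=> le_mm' rAB; elim: rAB m' le_mm' => {m A B} [m A|m i j A B ij _ IH] m'.
  by move=> _; apply: reach_refl.
by case: m' => // m' le_mm'; apply: (reach_step ij); apply: IH.
Qed.

Lemma reach_trans B m m' A C :
  reach m A B -> reach m' B C -> reach (m + m') A C.
Proof.
elim=> {m A B} [m A|m i j A B ij _ IH] rBC.
  by apply: reach_le rBC; apply: leq_addl.
by rewrite addSn; apply: (reach_step ij); apply: IH.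
Qed.

Lemma reach1 i j A : i != j -> reach 1 A (row_addition i j *m A).
Proof. by move/reach_step; apply; apply: reach_refl. Qed.

Lemma reach_unitmx m A B : reach m A B -> A \in unitmx -> B \in unitmx.
Proof.
elim=> // {m A B} m i j A B ij _ IH Au; apply: IH.
rewrite unitmx_mul Au andbT.
by have /mulmx1_unit[] := row_additionK ij.
Qed.

Lemma reach_add_sources s (f : 'I_n -> 'F_2) a A :
  a \notin s ->
  reach (size s) A
    (\matrix_(i, l) (A i l + if i == a then \sum_(k <- s) f k * A k l else 0)).
Proof.
elim: s A => [|p s IH] A /=.
  move=> _; set B := (B in reach _ _ B); suff -> : B = A by apply: reach_refl.
  by apply/matrixP => i l; rewrite mxE big_nil if_same addr0.
rewrite inE negb_or => /andP[ap as_].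
have [fp0|/F2_neq0 fp1] := eqVneq (f p) 0.
  apply: reach_le (leqnSn _) _; move: (IH A as_).
  congr reach; apply/matrixP => i l.
  by rewrite !mxE big_cons fp0 mul0r add0r.
rewrite -add1n; apply: reach_trans (reach1 _ ap) _.
move: (IH (row_addition a p *m A) as_); congr reach.
apply/matrixP => i l.
rewrite [LHS]mxE [RHS]mxE row_additionE big_cons fp1 mul1r.
case: (i == a); last by rewrite !addr0.
rewrite -addrA; congr (_ + (_ + _)); apply: eq_big_seq => k ks.
rewrite row_additionE; case: eqP => [ka|_]; last by rewrite addr0.
by rewrite -ka ks in as_.
Qed.

Lemma reach_add_targets T a A :
  a \notin T ->
  reach #|T| A (\matrix_(i, l) (A i l + if i \in T then A a l else 0)).
Proof.
rewrite cardE => aT.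
have {aT}: a \notin enum T by rewrite mem_enum.
have -> : (\matrix_(i, l) (A i l + if i \in T then A a l else 0)) =
    \matrix_(i, l) (A i l + if i \in enum T then A a l else 0).
  by apply/matrixP => i l; rewrite !mxE mem_enum.
elim: (enum T) (enum_uniq T) A => [|p s IH] /= us A.
  move=> _; set B := (B in reach _ _ B); suff -> : B = A by apply: reach_refl.
  by apply/matrixP => i l; rewrite mxE addr0.
move: us; rewrite inE negb_or => /andP[ps us] /andP[ap as_].
have pa : p != a by rewrite eq_sym.
rewrite -add1n; apply: reach_trans (reach1 _ pa) _.
move: (IH us (row_addition p a *m A) as_); congr reach.
apply/matrixP => i l.
rewrite [LHS]mxE [RHS]mxE !row_additionE inE (negPf ap) addr0.
have [->|_] := eqVneq i p; last by rewrite addr0.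
by rewrite (negPf ps) addr0.
Qed.

(* Row [a] accumulates: starting from [A a], it visits every sum of [A a] with a
   subset of the rows in [s].  For [s = p :: s'] the walk along [s'] serves the
   targets that do not involve [p], row [p] is added to row [a], and the walk
   along [s'] is repeated for the other targets.  Over F_2 the two walks along
   [s'] displace row [a] by the same vector, so only [A p] remains added. *)
Lemma reach_walk s a T (f : 'I_n -> 'I_n -> 'F_2) A :
  uniq s -> a \notin s -> a \notin T -> {in s, forall k, k \notin T} ->
  reach (#|T| + (2 ^ size s).-1) A
    (\matrix_(i, l) (A i l +
       if i \in T then A a l + \sum_(k <- s) f i k * A k l
       else if i == a then (if s is p :: _ then A p l else 0) else 0)).
Proof.
elim: s T f A => [|p s IH] T f A /=.
  move=> _ _ aT _; rewrite addn0; move: (reach_add_targets A aT).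
  congr reach; apply/matrixP => i l; rewrite !mxE big_nil addr0.
  by rewrite if_same.
rewrite inE negb_or => /andP[ps us] /andP[ap as_] aT sT.
pose T0 := [set i in T | f i p == 0]; pose T1 := [set i in T | f i p != 0].
have aT0 : a \notin T0 by rewrite inE (negPf aT).
have aT1 : a \notin T1 by rewrite inE (negPf aT).
have pT : p \notin T by apply: sT; rewrite inE eqxx.
have pa : (p == a) = false by rewrite eq_sym (negPf ap).
have sT' k : k \in s -> k \notin T by move=> ks; apply: sT; rewrite inE ks orbT.
have sa k : k \in s -> (k == a) = false.
  by move=> ks; apply/eqP => ka; rewrite -ka ks in as_.
have sT0 : {in s, forall k, k \notin T0}.
  by move=> k /sT'; rewrite inE => /negPf->.
have sT1 : {in s, forall k, k \notin T1}.
  by move=> k /sT'; rewrite inE => /negPf->.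
(* Two walks along [s] and the single addition of row [p] between them: 2 (2^|s| - 1) + 1 =
   2^(|s|+1) - 1. Each target is served in exactly one of the walks. *)
have -> : (#|T| + (2 ^ (size s).+1).-1 =
    #|T0| + (2 ^ size s).-1 + (1 + (#|T1| + (2 ^ size s).-1)))%N.
  have -> : #|T| = (#|T0| + #|T1|)%N.
    rewrite -(cardsID [set i | f i p == 0] T).
    by congr addn; apply: eq_card => i; rewrite !inE // andbC.
  by rewrite expnS; have := expn_gt0 2 (size s); lia.
apply: reach_trans (IH T0 f A us as_ aT0 sT0) _.
set A1 := (A1 in reach _ A1 _).
apply: reach_trans (reach1 _ ap) _; set A2 := _ *m A1.
(* The first walk leaves the head row of [s] added to row [a]. Toggling the coefficient of that head
   row makes the second walk cancel it in the targets. *)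
pose g i k := f i k + (ohead s == Some k)%:R.
move: (IH T1 g A2 us as_ aT1 sT1); congr reach.
pose h l := if s is q :: _ then A q l else 0.
have A1E i l : A1 i l = A i l +
    if i \in T0 then A a l + \sum_(k <- s) f i k * A k l
    else if i == a then h l else 0 by rewrite mxE.
have A2s k l : k \in s -> A2 k l = A k l.
  move=> ks; rewrite row_additionE A1E (negPf (sT0 _ ks)) (sa _ ks) //.
  by rewrite !addr0.
have A1p l : A1 p l = A p l by rewrite A1E inE (negPf pT) pa addr0.
have A2a l : A2 a l = A a l + h l + A p l.
  by rewrite row_additionE eqxx A1p A1E (negPf aT0) eqxx.
have A2E i l : i != a -> A2 i l = A1 i l.
  by move=> /negPf ia; rewrite row_additionE ia addr0.
have hE l : \sum_(k <- s) (ohead s == Some k)%:R * A k l = h l.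
  rewrite /h; case: (s) us => [|q r] /=; first by rewrite big_nil.
  move=> /andP[qr _]; rewrite big_cons eqxx mul1r big1_seq ?addr0 // => k /=.
  by move=> kr; case: eqP => [[qk]|_]; [rewrite qk kr in qr | rewrite mul0r].
apply/matrixP => i l; rewrite [LHS]mxE [RHS]mxE big_cons.
have -> : (if s is q :: _ then A2 q l else 0) = h l.
  rewrite /h; case: (s) A2s => [|q r] //= -> //; exact: mem_head.
have -> : \sum_(k <- s) g i k * A2 k l = \sum_(k <- s) f i k * A k l + h l.
  rewrite -hE -big_split; apply: eq_big_seq => k ks.
  by rewrite A2s // /g mulrDl.
rewrite inE; have [iT|iT] /= := boolP (i \in T); last first.
  have [->|ia] := eqVneq i a; first by rewrite A2a -!addrA
    [A p l + _]addrC [h l + _]addrA F2_addrr add0r.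
  by rewrite addr0 A2E // A1E inE (negPf iT) (negPf ia).
have ia : i != a by apply: contraNneq aT => <-.
rewrite (negPf ia) A2E // A1E inE iT /=.
have [->|/F2_neq0->] := eqVneq (f i p) 0.
  by rewrite /= !addr0 mul0r add0r.
rewrite /= (negPf ia) addr0 A2a mul1r.
set S := \sum_(k <- s) _; rewrite -!addrA; congr (_ + (_ + _)).
by rewrite addrCA; congr (_ + _); rewrite addrCA F2_addrr addr0.
Qed.

(** When [s] starts with [p], the walk ends with row [p] still added to row [a]. Row [p] itself has
    not changed, so one more addition restores row [a]; this raises 2^|s| - 1 to 2^|s|. *)
Lemma reach_clear s a T (f : 'I_n -> 'I_n -> 'F_2) A :
  uniq s -> a \notin s -> a \notin T -> {in s, forall k, k \notin T} ->
  reach (#|T| + 2 ^ size s) A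
    (\matrix_(i, l) (A i l +
       if i \in T then A a l + \sum_(k <- s) f i k * A k l else 0)).
Proof.
move=> us as_ aT sT; move: (reach_walk f A us as_ aT sT).
case: s us as_ sT => [|p s] us as_ sT.
  have le_cost :
      (#|T| + (2 ^ size (Nil 'I_n)).-1 <= #|T| + 2 ^ size (Nil 'I_n))%N.
    by rewrite leq_add2l leq_pred.
  move/(reach_le le_cost); congr reach; apply/matrixP => i l.
  by rewrite !mxE if_same.
have ap : a != p by move: as_; rewrite inE negb_or => /andP[].
move/reach_trans/(_ (reach1 _ ap)).
have -> : (#|T| + (2 ^ size (p :: s)).-1 + 1 = #|T| + 2 ^ size (p :: s))%N.
  by have := expn_gt0 2 (size (p :: s)); lia.
congr reach; apply/matrixP => i l; rewrite row_additionE !mxE.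
have pT : p \notin T by apply: sT; rewrite inE eqxx.
rewrite (negPf pT) [p == a]eq_sym (negPf ap) addr0.
have [->|ia] := eqVneq i a; last by rewrite addr0.
by rewrite (negPf aT) F2_addrK addr0.
Qed.

End RowAdditions.

(** * Reduction of an invertible matrix to the identity, section by section *)

Section Elimination.
Variable n : nat.
Implicit Types (A B : 'M['F_2]_n) (i j k l a p : 'I_n) (c t w m q r : nat).

Definition block c t := [seq k : 'I_n <- index_enum 'I_n | (c <= k < c + t)%N].

Lemma mem_block c t (k : 'I_n) : (k \in block c t) = (c <= k < c + t)%N.
Proof. by rewrite mem_filter mem_index_enum andbT. Qed.

Lemma block_uniq c t : uniq (block c t).
Proof. by rewrite filter_uniq // index_enum_uniq. Qed.

Lemma size_block c t : (size (block c t) <= t)%N.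
Proof.
rewrite -(size_map val) -[X in (_ <= X)%N](size_iota c t).
apply: uniq_leq_size; first by rewrite (map_inj_uniq val_inj) block_uniq.
by move=> _ /mapP[k k_in ->]; rewrite mem_iota -mem_block.
Qed.

Lemma sum_block_delta c t (f g : 'I_n -> 'F_2) l :
  {in block c t, forall k, g k = (k == l)%:R} ->
  \sum_(k <- block c t) f k * g k = if (c <= l < c + t)%N then f l else 0.
Proof.
move=> gE; rewrite (eq_big_seq (fun k => f k * (k == l)%:R)); last first.
  by move=> k /gE->.
rewrite big_filter big_mkcond (bigD1 l) //= eqxx mulr1 big1 ?addr0 // => k.
by move=> /negPf->; rewrite mulr0 if_same.
Qed.

(* The first [c] columns are unit vectors; in the [w] columns of the section
   starting at [c], the pivot rows [c, ..., c + w - 1] form the identity and the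
   columns from [c + t] on are already cleared. *)
Definition reduced c w t A :=
  forall i j, (j < c + w)%N -> [|| j < c, c <= i < c + w | c + t <= j]%N ->
  A i j = (i == j)%:R.

(** The size of this set is a potential that pays for the single additions clearing the targets: a
    row leaves the set once it has been cleared. *)
Definition pattern_rows c w t A :=
  [set i : 'I_n | ~~ (c <= i < c + w)%N &&
     [exists j : 'I_n, (c <= j < c + t)%N && (A i j != 0)]].

Lemma ord_neq i j : (nat_of_ord i != j) -> (i == j) = false.
Proof. by move=> ij; apply/negbTE. Qed.

(** The accumulator is pivot row [a] = c + t. The [m] targets are cleared on the whole section, so
    they drop out of [pattern_rows], and no new row enters; hence only 2^t is charged beyond the
    decrease of the potential. *)
Lemma reduced_clear_column c w t A :
  (t < w)%N -> (c + w <= n)%N -> reduced c w t.+1 A ->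
  exists2 B, reduced c w t B &
    exists2 m, reach (m + 2 ^ t) A B &
      (m + #|pattern_rows c w t B| <= #|pattern_rows c w t.+1 A|)%N.
Proof.
move=> lt_tw le_n redA.
have lt_an : (c + t < n)%N by lia.
pose a := Ordinal lt_an; pose s := block c t.
pose T := [set i : 'I_n | ~~ (c <= i < c + w)%N && (A i a != 0)].
have as_ : a \notin s by rewrite mem_block /=; lia.
have aT : a \notin T by rewrite inE /=; lia.
have sT : {in s, forall k, k \notin T}.
  by move=> k; rewrite mem_block inE; lia.
(* The pivot rows are the identity on the section, so the entries of a target row are themselves the
   coefficients of the preceding pivot rows that reproduce it there. *)
have := reach_clear A A (block_uniq c t) as_ aT sT.
set B := (B in reach _ _ B) => rAB.
have sE l : (l < c + w)%N -> {in s, forall k, A k l = (k == l)%:R}.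
  by move=> lt_l k; rewrite mem_block => ks; apply: redA; lia.
have BE i l : (l < c + w)%N ->
  B i l = A i l + if i \in T
    then (a == l)%:R + (if (c <= l < c + t)%N then A i l else 0) else 0.
  move=> lt_l; rewrite mxE; case: ifP => // _.
  rewrite (redA a) //=; last by lia.
  congr (_ + (_ + _)); apply: (sum_block_delta (A i)); exact: sE.
exists B.
  move=> i l lt_l; rewrite BE // => Hil.
  have [iT|iT] := boolP (i \in T).
    move: (iT); rewrite inE => /andP[ip /F2_neq0 Aia1].
    have [<-|al] := eqVneq a l.
      rewrite Aia1 /= ifF ?addr0 ?F2_addrr; last by lia.
      by rewrite ord_neq //=; lia.
    have neq_al : nat_of_ord a != l by [].
    rewrite ifF; last by move: Hil neq_al; rewrite /=; lia.
    rewrite !addr0; apply: redA => //; move: Hil neq_al; rewrite /=; lia.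
  rewrite addr0; have [al|al] := eqVneq a l.
    rewrite -al; move: iT; rewrite inE negb_and !negbK => /orP[ip|/eqP Aia0].
      by apply: redA; rewrite /= ?ip ?orbT //; lia.
    have [ip|ip] := boolP (c <= i < c + w)%N.
      by apply: redA; rewrite /= ?ip ?orbT //; lia.
    by rewrite Aia0 ord_neq //=; lia.
  have neq_al : nat_of_ord a != l by [].
  apply: redA => //; move: Hil neq_al; rewrite /=; lia.
exists #|T|.
  apply: reach_le rAB; rewrite leq_add2l leq_exp2l //; exact: size_block.
have BT i : i \in T -> i \notin pattern_rows c w t B.
  move=> iT; rewrite inE negb_and; apply/orP; right.
  apply/existsPn => l; rewrite negb_and negbK -implybE; apply/implyP => lt_l.
  rewrite BE; last by lia.
  by rewrite iT lt_l ord_neq /= ?add0r ?F2_addrr //; lia.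
have TB0 : [disjoint T & pattern_rows c w t B].
  by rewrite disjoint_subset; apply/subsetP => i /BT.
rewrite -(eqTleqif (leq_card_setU _ _) TB0); apply: subset_leq_card.
apply/subsetP => i; rewrite inE; have [iT _|iT] /= := boolP (i \in T).
  move: iT; rewrite !inE => /andP[-> Aia] /=; apply/existsP; exists a.
  by rewrite Aia /= andbT; lia.
rewrite !inE => /andP[-> /existsP[l /andP[lt_l]]] /=.
rewrite BE; last by lia.
rewrite (negPf iT) addr0 => Ail; apply/existsP; exists l.
by rewrite Ail andbT; lia.
Qed.

(** The decreases of the potential telescope, and 2^0 + ... + 2^(t-1) < 2^t. *)
Lemma reduced_clear c w t A :
  (t <= w)%N -> (c + w <= n)%N -> reduced c w t A ->
  exists2 B, reduced c w 0 B & reach (#|pattern_rows c w t A| + 2 ^ t) A B.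
Proof.
elim: t A => [|t IH] A le_tw le_n redA.
  by exists A => //; apply: reach_refl.
have [B redB [m rAB le_m]] := reduced_clear_column le_tw le_n redA.
have [C redC rBC] := IH B (ltnW le_tw) le_n redB; exists C => //.
apply: reach_le (reach_trans rAB rBC); rewrite expnS; lia.
Qed.

(** The displayed sum is what entry (i, c + t) becomes once the block entries of row i have been
    cleared with the pivot rows. If it vanished for every i >= c + t, the vector [y] below would be
    sent by [A] into the span of the first c unit vectors. [A] fixes these, so correcting [y] by
    such a vector [z] would give a kernel vector with entry 1 at [a], against invertibility. *)
Lemma exists_pivot c t A (lt_ct : (c + t < n)%N) :
  A \in unitmx -> reduced c t t A ->
  exists2 i : 'I_n, (c + t <= i)%N &
    A i (Ordinal lt_ct) +
      \sum_(k <- block c t) A i k * A k (Ordinal lt_ct) != 0.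
Proof.
move=> Au redA; set a := Ordinal lt_ct.
pose x i := A i a + \sum_(k <- block c t) A i k * A k a.
have [/exists_inP[i lt_i xi]|/exists_inPn x0] :=
  boolP [exists i in [pred i : 'I_n | c + t <= i]%N, x i != 0].
  by exists i.
pose y : 'cV['F_2]_n :=
  \col_k (if (c <= k < c + t)%N then A k a else (k == a)%:R).
have xE i : (A *m y) i 0 = x i.
  rewrite mxE (bigD1 a) //= mxE eqxx ifF /=; last by lia.
  rewrite mulr1; congr (_ + _); rewrite big_filter big_mkcond [RHS]big_mkcond.
  apply: eq_bigr => k _; rewrite mxE.
  have [->|ka] := eqVneq k a; first by rewrite /= ifF //=; lia.
  by case: ifP => //; rewrite mulr0.
pose z : 'cV['F_2]_n := \col_k (if (k < c)%N then x k else 0).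
have zE i : (A *m z) i 0 = if (i < c)%N then x i else 0.
  rewrite mxE (bigD1 i) //= mxE big1 => [|k ki].
    rewrite addr0; case: ifP => [ic|]; last by rewrite mulr0.
    by rewrite redA ?ic ?eqxx ?mul1r //; lia.
  rewrite mxE; case: ifP => [kc|]; last by rewrite mulr0.
  by rewrite redA ?kc //; [rewrite eq_sym (negPf ki) mul0r | lia].
have Ayz0 : A *m (y + z) = 0.
  apply/matrixP => i j; rewrite ord1 mulmxDr mxE xE zE mxE.
  have [ic|ci] := ltnP i c; first by rewrite F2_addrr.
  rewrite addr0; have [lt_i|le_i] := ltnP i (c + t).
    rewrite /x (eq_bigr _ (fun k _ => mulrC (A i k) (A k a))).
    rewrite (sum_block_delta (fun k => A k a) (l := i)) => [|k].
      by rewrite ci lt_i F2_addrr.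
    by rewrite mem_block eq_sym => lt_k; apply: redA; lia.
  by have := x0 i le_i; rewrite negbK => /eqP.
have : y + z = 0 by rewrite -(mulKmx Au (y + z)) Ayz0 mulmx0.
move/matrixP/(_ a 0); rewrite !mxE eqxx !ifF /=; try lia.
by rewrite addr0.
Qed.

(** One addition makes the future pivot entry nonzero if necessary, at most t additions clear row
    [a] on the block, and at most t more clear column [a] in the block rows. *)
Lemma reduced_add_pivot c t A :
  (c + t < n)%N -> A \in unitmx -> reduced c t t A ->
  exists2 B, reduced c t.+1 t.+1 B & reach (2 * t).+1 A B.
Proof.
move=> lt_ct Au redA; pose a := Ordinal lt_ct; pose s := block c t.
have as_ : a \notin s by rewrite mem_block /=; lia.
pose x (M : 'M['F_2]_n) i := M i a + \sum_(k <- s) M i k * M k a.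
(* [x] is additive in row i as long as the block rows stay fixed, so adding a row with [x] = 1 to
   row [a] turns [x] at [a] from 0 into 1. *)
have [A1 redA1 [rA1 xA1]] : exists2 A1, reduced c t t A1 &
    reach 1 A A1 /\ x A1 a = 1.
  have [xa0|/F2_neq0 xa1] := eqVneq (x A a) 0; last first.
    by exists A => //; split => //; apply: reach_refl.
  have [i le_i /F2_neq0 xi1] := exists_pivot lt_ct Au redA.
  have ai : a != i.
    by apply: contra_eqN xa0 => /eqP->; rewrite /x xi1 oner_neq0.
  have addE k l : k != a -> (row_addition a i *m A) k l = A k l.
    by move=> /negPf ka; rewrite row_additionE ka addr0.
  exists (row_addition a i *m A).
    move=> k l lt_l Hkl; rewrite row_additionE (redA k) //.
    have [ka|_] := eqVneq k a; last by rewrite addr0.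
    rewrite (redA i) ?ord_neq ?addr0 //; move: Hkl; rewrite ka /=; lia.
  split; first exact: reach1.
  rewrite /x row_additionE eqxx.
  rewrite (eq_big_seq (fun k => A a k * A k a + A i k * A k a)) => [|k ks].
    by rewrite big_split /= addrACA -/(x A a) xa0 add0r.
  rewrite row_additionE eqxx addE ?mulrDl //.
  by apply: contraNneq as_ => <-.
(* With its own block entries as coefficients, row [a] loses these entries, and its entry in column
   [a] becomes [x A1 a] = 1. *)
have := reach_add_sources (A1 a) A1 as_.
set A2 := (A2 in reach _ _ A2) => rA2.
have A2a l : (l <= c + t)%N -> A2 a l = (a == l)%:R.
  move=> le_l; rewrite mxE eqxx.
  have [<-|al] := eqVneq a l; first exact: xA1.
  have neq_al : nat_of_ord a != l by [].
  have lt_l : (l < c + t)%N by move: neq_al; rewrite /=; lia.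
  rewrite (sum_block_delta (A1 a) (l := l)) => [|k].
    case: ifP => [_|lc]; first by rewrite F2_addrr.
    by rewrite redA1 ?addr0 ?ord_neq //=; lia.
  by rewrite mem_block => ks; apply: redA1; lia.
have A2E i l : i != a -> A2 i l = A1 i l.
  by move=> /negPf ia; rewrite mxE ia addr0.
pose T := [set i : 'I_n | (c <= i < c + t)%N && (A2 i a != 0)].
have aT : a \notin T by rewrite inE /=; lia.
have := reach_add_targets A2 aT; set B := (B in reach _ _ B) => rB.
have le_T : (#|T| <= t)%N.
  apply: leq_trans (size_block c t); rewrite -(card_uniqP (block_uniq c t)).
  by apply/subset_leq_card/subsetP => i; rewrite inE mem_block => /andP[].
exists B.
  move=> i l lt_l Hil; rewrite mxE.
  have [->|ia] := eqVneq i a; first by rewrite (negPf aT) addr0 A2a //; lia.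
  have neq_ia : nat_of_ord i != a by [].
  have [la|la] := eqVneq l a.
    rewrite la (negPf ia) inE; have [ic|ic] := boolP (c <= i < c + t)%N => /=.
      have [->|/F2_neq0->] := eqVneq (A2 i a) 0; first by rewrite addr0.
      by rewrite A2a ?eqxx ?F2_addrr /=.
    by move: Hil neq_ia; rewrite la /=; lia.
  have neq_la : nat_of_ord l != a by [].
  have lt_l' : (l < c + t)%N by move: neq_la; rewrite /=; lia.
  have -> : (if i \in T then A2 a l else 0) = 0.
    by case: ifP => // _; rewrite A2a ?ord_neq 1?eq_sym //; lia.
  rewrite addr0 A2E //; apply: redA1 => //; move: Hil neq_ia; rewrite /=; lia.
apply: reach_le (reach_trans rA1 (reach_trans rA2 rB)).
by rewrite add1n ltnS mul2n -addnn leq_add // size_block.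
Qed.

(** The costs 2t + 1 for t < w are the first w odd numbers, with sum w^2. *)
Lemma reduced_pivots c w A :
  (c + w <= n)%N -> A \in unitmx -> reduced c 0 0 A ->
  exists2 B, reduced c w w B & reach (w ^ 2) A B.
Proof.
elim: w => [|w IH] le_n Au redA; first by exists A => //; apply: reach_refl.
have [|B redB rAB] := IH _ Au redA; first by lia.
have [|C redC rBC] := reduced_add_pivot _ (reach_unitmx rAB Au) redB.
  by lia.
by exists C => //; apply: reach_le (reach_trans rAB rBC); lia.
Qed.

Lemma reduced_section c w A :
  (c + w <= n)%N -> A \in unitmx -> reduced c 0 0 A ->
  exists2 B, reduced (c + w) 0 0 B & reach (w ^ 2 + (n + 2 ^ w)) A B.
Proof.
move=> le_n Au redA; have [B redB rAB] := reduced_pivots le_n Au redA.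
have [C redC rBC] := reduced_clear (leqnn w) le_n redB; exists C.
  by move=> i j lt_j _; apply: redC; lia.
apply: reach_le (reach_trans rAB rBC); rewrite !leq_add2l leq_add2r.
by rewrite -[X in (_ <= X)%N]card_ord max_card.
Qed.

Lemma reach_sections m q r c A :
  (c + (q * m + r) = n)%N -> A \in unitmx -> reduced c 0 0 A ->
  reach (q * (m ^ 2 + (n + 2 ^ m)) + (r ^ 2 + (n + 2 ^ r))) A 1%:M.
Proof.
elim: q c A => [|q IH] c A cE Au redA.
  rewrite mul0n add0n in cE *.
  have [|B redB rAB] := reduced_section (w := r) _ Au redA; first by lia.
  suff <- : B = 1%:M by [].
  by apply/matrixP => i j; rewrite mxE; apply: redB; have := ltn_ord j; lia.
have {}cE : (c + (m + (q * m + r)) = n)%N by rewrite -cE mulSn -!addnA.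
have [|B redB rAB] := reduced_section (w := m) _ Au redA; first by lia.
rewrite mulSn -addnA; apply: (reach_trans rAB).
by apply: (IH _ _ _ (reach_unitmx rAB Au) redB); lia.
Qed.

Lemma reach_identity m A :
  (0 < m)%N -> (2 ^ m <= n)%N -> A \in unitmx ->
  reach (2 * n * (n %/ m) + 2 * n * m + n) A 1%:M.
Proof.
move=> m_gt0 le_mn Au.
have red0 : reduced 0 0 0 A by [].
apply: reach_le (reach_sections (c := 0) (esym (divn_eq n m)) Au red0).
have := ltn_pmod n m_gt0; have := divn_eq n m.
set q := (n %/ m)%N; set r := (n %% m)%N => nE lt_rm.
have le_r : (2 ^ r <= n)%N by apply: leq_trans le_mn; rewrite leq_exp2l // ltnW.
(* With q m + r = n and r < m, q m^2 + r^2 <= n m. The powers of 2 are at most n, so the remaining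
   terms are at most 2 n q + 2 n; finally n m + 2 n <= 2 n m + n because m >= 1. *)
nia.
Qed.

End Elimination.

(** * Row additions and translations as gates *)

Section Gates.
Variable n : nat.
Implicit Types (g h : {perm bitstring n}) (i j k : 'I_n) (b c d : bitstring n).
Implicit Types (A B : 'M['F_2]_n) (m : nat).

(** Products of at most [m] gates, unlike the exact length in [composition_of_gates], so that bounds
    can be weakened freely. *)
Definition gate_product m g :=
  exists s : seq {perm bitstring n},
    [/\ all [in local_gates n] s, (size s <= m)%N & g = (\prod_(h <- s) h)%g].

Lemma complexity_le m g (Gg : g \in gate_group n) :
  gate_product m g -> (complexity Gg <= m)%N.
Proof.
move=> [s [s_gates le_s gE]]; rewrite /complexity.
case: ex_minnP => k _ min_k; apply: leq_trans (min_k (size s) _) le_s.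
by apply/existsP; exists (in_tuple s); rewrite s_gates gE eqxx.
Qed.

Lemma gate_product1 m : gate_product m 1%g.
Proof. by exists [::]; split=> //; rewrite big_nil. Qed.

Lemma gate_product_le m m' g :
  (m <= m')%N -> gate_product m g -> gate_product m' g.
Proof.
by move=> le_mm' [s [? le_s ?]]; exists s; split=> //; apply: leq_trans le_mm'.
Qed.

Lemma gate_productM m g h :
  g \in local_gates n -> gate_product m h -> gate_product m.+1 (g * h)%g.
Proof.
move=> gate_g [s [s_gates le_s ->]]; exists (g :: s); split=> //=.
  by rewrite gate_g s_gates.
by rewrite big_cons.
Qed.

(** The permutation of the plane is read off [g] on the strings that vanish outside i and j; it is
    injective because [g] is. The criterion is symmetric in i and j, so users need not order the two
    coordinates. *)
Lemma mem_local_gates i j g :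
  i != j ->
  (forall c k, k != i -> k != j -> g c 0 k = c 0 k) ->
  (forall c d, c 0 i = d 0 i -> c 0 j = d 0 j ->
     g c 0 i = g d 0 i /\ g c 0 j = g d 0 j) ->
  g \in local_gates n.
Proof.
wlog lt_ij : i j / (i < j)%N => [wl ij gk gij|].
  have [lt|lt|/val_inj eq] := ltngtP i j; first exact: (wl i j).
    apply: (wl j i) => //; first by rewrite eq_sym.
      by move=> c k kj ki; apply: gk.
    by move=> c d cj ci; have [] := gij c d ci cj.
  by rewrite eq eqxx in ij.
move=> ij gk gij.
pose e (x : bitstring 2) : bitstring n :=
  \row_k (if k == i then x 0 0 else if k == j then x 0 1 else 0).
have ei x : e x 0 i = x 0 0 by rewrite mxE eqxx.
have ej x : e x 0 j = x 0 1 by rewrite mxE eq_sym (negPf ij) eqxx.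
have ek x k : k != i -> k != j -> e x 0 k = 0.
  by move=> /negPf ki /negPf kj; rewrite mxE ki kj.
have row2P (x y : bitstring 2) : x 0 0 = y 0 0 -> x 0 1 = y 0 1 -> x = y.
  move=> xy0 xy1; apply/rowP => k.
  have /orP[/eqP->|/eqP->] // : (k == 0) || (k == 1) by case: k => -[|[|]].
pose s x := coord_pair i j (g (e x)).
have s_inj : injective s.
  move=> x y /rowP eq_xy.
  have gi : g (e x) 0 i = g (e y) 0 i by have := eq_xy 0; rewrite !mxE eqxx.
  have gj : g (e x) 0 j = g (e y) 0 j by have := eq_xy 1; rewrite !mxE.
  have exy : e x = e y.
    apply/(@perm_inj _ g)/rowP => k.
    have [->//|ki] := eqVneq k i; have [->//|kj] := eqVneq k j.
    by rewrite !gk // !ek.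
  by apply: row2P; rewrite -?ei -?ej exy.
apply/imset2P; exists (perm s_inj) (exist _ (i, j) lt_ij : index_pair n) => //.
apply/permP => c; rewrite permE /local_gate_fun /=; apply/rowP => k.
rewrite [RHS]mxE permE /s; set x := coord_pair i j c.
have [||gi gj] := gij c (e x); rewrite ?ei ?ej; try by rewrite /x mxE.
have [->|ki] := eqVneq k i; first by rewrite mxE.
have [->|kj] := eqVneq k j; first by rewrite mxE.
exact: gk.
Qed.

(** The map [e] sending [c] to [c *m row_addition i j] is a gate and an involution. In g = e (e g)
    the gate [e] acts first, and e g has matrix [row_addition i j *m A] with the same translation
    part, so each row addition on the matrix splits off one gate. *)
Lemma gate_product_reach m m' A B b g :
  reach m A B -> (forall c, g c = c *m A + b) ->
  (forall h, (forall c, h c = c *m B + b) -> gate_product m' h) ->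
  gate_product (m + m') g.
Proof.
move=> rAB; elim: rAB g => {A B} [l A|l i j A B ij _ IH] g gE hP.
  by apply: gate_product_le (leq_addl _ _) (hP _ gE).
have E_inj : injective (fun c => c *m row_addition i j).
  apply: (can_inj (g := fun c => c *m row_addition i j)) => c.
  by rewrite -mulmxA row_additionK // mulmx1.
pose e := perm E_inj.
have cE c k : (c *m row_addition i j) 0 k = c 0 k + if k == j then c 0 i else 0.
  rewrite mulmxDr mulmx1 mxE; congr (_ + _).
  rewrite mxE (bigD1 i) //= mxE eqxx big1 ?addr0 => [|p /negPf pi].
    by case: (k == j); rewrite ?mulr1 ?mulr0.
  by rewrite mxE pi mulr0.
have gate_e : e \in local_gates n.
  apply: (mem_local_gates ij) => [c k ki kj|c d ci cj]; rewrite !permE !cE.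
    by rewrite (negPf kj) addr0.
  by rewrite eqxx (negPf ij) ci cj.
have eK : (e * e = 1)%g.
  by apply/permP => c; rewrite permM !permE /= -mulmxA row_additionK // mulmx1.
have -> : g = (e * (e * g))%g by rewrite mulgA eK mul1g.
rewrite addSn; apply: gate_productM => //; apply: IH => // c.
by rewrite permM permE gE mulmxA.
Qed.

Definition ones b := [set k : 'I_n | b 0 k != 0].

(** One gate translates by the part of [b] on two coordinates, so two ones are removed at a time. *)
Lemma gate_product_translation m b g :
  (1 < n)%N -> (forall c, g c = c + b) -> (#|ones b| <= m)%N ->
  gate_product (uphalf m) g.
Proof.
move=> n_gt1; elim/ltn_ind: m b g => m IH b g gE le_m.
have [b0|/rV0Pn[i bi]] := eqVneq b 0.
  suff -> : g = 1%g by apply: gate_product1.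
  by apply/permP => c; rewrite gE b0 addr0 perm1.
(* A second one of [b] if there is any; otherwise an arbitrary coordinate other than [i], which
   exists since n > 1. *)
have [j ji jP] : exists2 j, j != i &
    (b 0 j != 0) || [forall k, (k != i) ==> (b 0 k == 0)].
  have [b0|/forallPn[j]] :=
    boolP [forall k, (k != i) ==> (b 0 k == 0)]; last first.
    by rewrite negb_imply => /andP[ji bj]; exists j => //; rewrite bj.
  have : (0 < #|[set~ i]|)%N by rewrite cardsC1 card_ord; lia.
  by case/card_gt0P => j; rewrite !inE => ji; exists j => //; rewrite orbT.
pose b' : bitstring n := \row_k (if k \in [set i; j] then b 0 k else 0).
pose e := perm (addIr b').
have gate_e : e \in local_gates n.
  apply: (@mem_local_gates j i) => // [c k kj ki|c d cj ci];
    rewrite !permE !mxE.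
    by rewrite !inE (negPf ki) (negPf kj) addr0.
  by rewrite ci cj.
have b'K c : c + b' + b' = c.
  by apply/rowP => k; rewrite !mxE F2_addrK.
have eK : (e * e = 1)%g by apply/permP => c; rewrite permM !permE /= b'K.
have -> : g = (e * (e * g))%g by rewrite mulgA eK mul1g.
have supp_b : ones (b' + b) = ones b :\: [set i; j].
  apply/setP => k; rewrite !inE !mxE !inE.
  by case: ifP => _; rewrite ?F2_addrr ?eqxx ?add0r.
have m_gt0 : (0 < m)%N.
  by apply: leq_trans le_m; apply/card_gt0P; exists i; rewrite inE.
have le_m2 : (#|ones (b' + b)| <= m.-2)%N.
  rewrite supp_b; case/orP: jP => [bj|/forall_inP b0].
    have := cardsID [set i; j] (ones b).
    have /setIidPr-> : [set i; j] \subset ones b.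
      by apply/subsetP => k; rewrite !inE => /orP[]/eqP->.
    by rewrite cards2 eq_sym ji => card_b; rewrite -subn2 leq_subRL; lia.
  rewrite (_ : _ :\: _ = set0) ?cards0 //; apply/setP => k; rewrite !inE.
  by have [//|/b0 /eqP->] := eqVneq k i; rewrite eqxx andbF.
(* For m = 1 the truncated [m.-2] is 0, and the last one costs a gate of its own. *)
have -> : uphalf m = (uphalf m.-2).+1 by case: (m) m_gt0 => [|[]].
apply: (gate_productM gate_e); apply: IH le_m2 => [|c]; first by lia.
by rewrite permM permE gE addrA.
Qed.

End Gates.

(** * Affinity of the group, and complexity bounds in the natural numbers *)

Section Affine.
Variable n : nat.
Implicit Types (g h : {perm bitstring n}) (c d : bitstring n).

(* If x, y and z are distinct, then s (x + y + z) and s x + s y + s z both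
   differ from s x, s y and s z, and there are only four bit strings of length 2. *)
Lemma perm_bitstring2_affine (s : {perm bitstring 2}) x y z :
  s (x + y + z) = s x + s y + s z.
Proof.
have addK m (u : bitstring m) : u + u = 0.
  by apply/rowP => k; rewrite !mxE F2_addrr.
have addKK m (u v : bitstring m) : u + v + v = u by rewrite -addrA addK addr0.
have addKl m (u v : bitstring m) : u + u + v = v by rewrite addK add0r.
have addKm m (u v : bitstring m) : u + v + u = v by rewrite addrAC addK add0r.
have addN m (u v w : bitstring m) : u != v -> u + v + w != w.
  apply: contraNneq => /(canRL (addrK _)); rewrite subrr => uv0.
  by rewrite -(addKK _ u v) uv0 add0r.
have [->|xy] := eqVneq x y; first by rewrite !addKl.
have [->|xz] := eqVneq x z; first by rewrite !addKm.
have [->|yz] := eqVneq y z; first by rewrite !addKK.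
have neqs m (u v w : bitstring m) : u != v -> u != w -> v != w ->
    [&& u + v + w != u, u + v + w != v & u + v + w != w].
  move=> uv uw vw; rewrite addN // andbT [u + v + w]addrAC addN // andbT.
  by rewrite [u + w]addrC addrAC [w + v]addrC addN.
have /and3P[w1 w2 w3] := neqs _ _ _ _ xy xz yz.
have sneq u v : u != v -> s u != s v by rewrite (inj_eq perm_inj).
have /and3P[t1 t2 t3] := neqs _ _ _ _ (sneq _ _ xy) (sneq _ _ xz) (sneq _ _ yz).
apply/eqP; apply: contraT => neq.
have : uniq [:: s (x + y + z); s x + s y + s z; s x; s y; s z].
  by rewrite /= !inE !negb_or neq !sneq // t1 t2 t3.
move/card_uniqP => /= card5.
have := max_card (mem [:: s (x + y + z); s x + s y + s z; s x; s y; s z]).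
by rewrite card5 card_mx card_Fp.
Qed.

(** Over F_2, preserving sums of three vectors amounts to being affine. In this form the property
    passes to products at once and is checked on a gate coordinate by coordinate. *)
Lemma gate_group_affine g c1 c2 c3 :
  g \in gate_group n -> g (c1 + c2 + c3) = g c1 + g c2 + g c3.
Proof.
case/gen_prodgP => k [f fP ->].
elim/big_ind: _ c1 c2 c3 => [c1 c2 c3|x y IHx IHy c1 c2 c3|i _].
- by rewrite !perm1.
- by rewrite !permM IHx IHy.
have /imset2P[s [[p q] lt_pq] _ _ ->] := fP i; move=> c1 c2 c3.
rewrite !permE /local_gate_fun /=; apply/rowP => l; rewrite !mxE.
have -> : coord_pair p q (c1 + c2 + c3) =
    coord_pair p q c1 + coord_pair p q c2 + coord_pair p q c3.
  by apply/rowP => o; rewrite !mxE; case: ifP.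
by rewrite perm_bitstring2_affine !mxE; do 2?case: ifP => // _.
Qed.

Lemma gate_group_affineP g : g \in gate_group n ->
  exists2 A : 'M['F_2]_n, A \in unitmx & forall c, g c = c *m A + g 0.
Proof.
move=> Gg; pose h c := g c + g 0.
have gK c : h c + g 0 = g c by apply/rowP => k; rewrite !mxE F2_addrK.
have hD : {morph h : c d / c + d}.
  move=> c d; rewrite /h -[in LHS](addr0 (c + d)) gate_group_affine //.
  by apply/rowP => k; rewrite !mxE F2_addrK addrACA F2_addrr addr0.
have h0 : h 0 = 0 by apply/rowP => k; rewrite !mxE F2_addrr.
pose A : 'M['F_2]_n := \matrix_(i, j) h (delta_mx 0 i) 0 j.
have hE c : h c = c *m A.
  rewrite mulmx_sum_row [in LHS](row_sum_delta c) (big_morph h hD h0).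
  apply: eq_bigr => i _; have -> : row i A = h (delta_mx 0 i).
    by apply/rowP => k; rewrite !mxE.
  have [->|/F2_neq0->] := eqVneq (c 0 i) 0; last by rewrite !scale1r.
  by rewrite !scale0r h0.
exists A; last by move=> c; rewrite -hE gK.
(* A vector killed by [A] has the same image under [g] as 0. *)
rewrite -row_free_unit; apply: inj_row_free => v vA0.
by apply: (@perm_inj _ g); rewrite -gK hE vA0 add0r.
Qed.

Lemma complexity_le_nat m g (Gg : g \in gate_group n) :
  (1 < n)%N -> (0 < m)%N -> (2 ^ m <= n)%N ->
  (complexity Gg <= 2 * n * (n %/ m) + 2 * n * m + n + uphalf n)%N.
Proof.
move=> n_gt1 m_gt0 le_mn; have [A Au gE] := gate_group_affineP Gg.
have rA := reach_identity m_gt0 le_mn Au.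
apply/complexity_le/(gate_product_reach rA gE) => h hE.
apply: (gate_product_translation (b := g 0)) => // [c|].
  by rewrite hE mulmx1.
by rewrite -[X in (_ <= X)%N]card_ord max_card.
Qed.

(** For n = 2 the two coordinates are the whole string, so every permutation is itself a gate. *)
Lemma complexity_le1 g (Gg : g \in gate_group n) :
  n = 2 -> (complexity Gg <= 1)%N.
Proof.
move=> n2; apply: complexity_le; rewrite -[g]mulg1.
apply: gate_productM (gate_product1 _ 0).
have lt0 : (0 < n)%N by rewrite n2.
have lt1 : (1 < n)%N by rewrite n2.
have ord2 k : (k == Ordinal lt0) || (k == Ordinal lt1).
  by rewrite -!val_eqE /=; have := ltn_ord k; lia.
apply: (@mem_local_gates _ (Ordinal lt0) (Ordinal lt1)) => //
  [c k k0 k1|c d c0 c1].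
  by have := ord2 k; rewrite (negPf k0) (negPf k1).
suff -> : c = d by [].
by apply/rowP => k; have /orP[/eqP->|/eqP->] := ord2 k.
Qed.

(** A single coordinate admits no pair i < j, so there are no gates and the group is trivial. *)
Lemma complexity_le0 g (Gg : g \in gate_group n) : n = 1 -> complexity Gg = 0.
Proof.
move=> n1; apply/eqP; rewrite -leqn0; apply: complexity_le.
suff -> : g = 1%g by apply: gate_product1.
have gates0 : local_gates n = set0.
  apply/setP => x; rewrite inE; apply/imset2P => -[s [[p q] /= lt_pq] _ _ _].
  by have := ltn_ord q; lia.
by move: Gg; rewrite /gate_group /= gates0 gen0 inE => /eqP.
Qed.

End Affine.

(** * Logarithms, and passage to the real bound *)

Lemma uphalf_le_ceil (R : realType) (n : nat) :
  (uphalf n)%:R <= (Num.ceil (n%:R / 2 : R))%:~R :> R.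
Proof.
have := ceil_ge (n%:R / 2 : R); set z := Num.ceil _.
rewrite ler_pdivrMr // -[n%:R]/((n%:Z)%:~R) -[2]/((2%:Z)%:~R) -intrM ler_int.
by rewrite -[(uphalf n)%:R]/((uphalf n)%:Z%:~R) ler_int; lia.
Qed.

Lemma log2X (R : realType) (m : nat) : log2 (2 ^+ m : R) = m%:R.
Proof.
have ln2_gt0 : 0 < ln (2 : R) by apply: ln_gt0; rewrite ltr1n.
by rewrite /log2 lnXn // -[_ *+ _]mulr_natl mulfK ?gt_eqF.
Qed.

Lemma ltr_log2 (R : realType) (x y : R) : 0 < x -> x < y -> log2 x < log2 y.
Proof.
move=> x_gt0 lt_xy.
have ln2_gt0 : 0 < ln (2 : R) by apply: ln_gt0; rewrite ltr1n.
by rewrite ltr_pM2r ?invr_gt0 // ltr_ln ?posrE // (lt_trans x_gt0).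
Qed.

Theorem theorem3p4 (R : realType) (n : nat) (n_gt0 : (0 < n)%N)
    (g : {perm bitstring n}) (Gg : g \in gate_group n) :
  (complexity Gg)%:R <=
    2 * n%:R ^+ 2 / (log2 (n%:R : R) - 1) + 2 * n%:R * log2 (n%:R : R)
    + n%:R + (Num.ceil (n%:R / 2 : R))%:~R.
Proof.
have log2_1 : log2 (1 : R) = 0 by rewrite -[1]/(2 ^+ 0) log2X.
have log2_2 : log2 (2 : R) = 1 by rewrite -[X in log2 X]expr1 log2X.
have ceil_n := uphalf_le_ceil R n.
have [n_le2|n_gt2] := leqP n 2.
  have [n1|n2] : n = 1%N \/ n = 2%N by lia.
    (* For n = 1 the bound equals -2 + 0 + 1 + 1 = 0, so it is attained. *)
    rewrite (complexity_le0 Gg n1); move: ceil_n.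
    by rewrite n1 log2_1 sub0r invrN1 expr1n /=; lra.
  (* The first summand vanishes, as [log2 2 - 1 = 0] and [x / 0 = 0]. *)
  have : (complexity Gg)%:R <= 1 :> R by rewrite lern1 complexity_le1.
  move: (complexity Gg) ceil_n => k.
  by rewrite n2 log2_2 subrr invr0 mulr0 /=; lra.
pose m := trunc_log 2 n; set L := log2 _.
have m_gt0 : (0 < m)%N by rewrite trunc_log_gt0 //; lia.
have le_mn : (2 ^ m <= n)%N by apply: trunc_logP.
have lt_nm : (n < 2 ^ m.+1)%N by apply: trunc_log_ltn.
have L_gt1 : 1 < L by rewrite -log2_2 ltr_log2 // ltr_nat.
have le_mL : m%:R <= L.
  rewrite -(log2X R m) /L -natrX.
  move: le_mn; rewrite leq_eqVlt => /orP[/eqP->//|lt_mn].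
  by apply/ltW/ltr_log2; rewrite ?ltr_nat ?ltr0n ?expn_gt0.
have lt_Lm : L < m.+1%:R.
  by rewrite -(log2X R m.+1) /L -natrX ltr_log2 ?ltr0n // ltr_nat.
(* Since m is the integer part of L, L - 1 < m <= L: the lower bound on m controls the number of
   sections and gives the first summand, the upper bound gives the second. *)
have le_q : (n %/ m)%:R <= n%:R / (L - 1).
  rewrite ler_pdivlMr ?subr_gt0 //.
  apply: (@le_trans _ _ ((n %/ m)%:R * m%:R)).
    by rewrite ler_wpM2l // lerBlDr natr1 ltW.
  by rewrite -natrM ler_nat leq_trunc_div.
have := complexity_le_nat Gg (ltnW n_gt2) m_gt0 le_mn.
rewrite -(ler_nat R) !natrD !natrM => /le_trans; apply.
have -> : 2 * n%:R ^+ 2 / (L - 1) = 2 * n%:R * (n%:R / (L - 1)).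
  by rewrite expr2 !mulrA.
by rewrite !lerD // ler_wpM2l // mulr_ge0.
Qed.
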